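(* Let $X$ be a Banach space. The following assertions are equivalent: (S) for any quasi-finite set $A\subset X$ there exists a dense set $Y\subset X$ such that for all $y\in Y$ and $n\in\mathbb{N}$ there exists a ball $B$ centred at $y$ with $|A\cap B|=n$; (S$_1$) for any quasi-finite set $A\subset X$ there exists a dense set $Y\subset X$ such that for every $y\in Y$ there exists a ball $B$ centred at $y$ with $|A\cap B|=1$; (S') for all $x,y\in X$ with $x\neq y$, $\|x\|=\|y\|=1$ and each $\delta>0$ there exists a $z\in X$ with $\|z\|<\delta$ such that one of the vectors $x+z$ and $y+z$ has norm greater than $1$, whereas the other has norm smaller than $1$; (S'') for all $x,y\in X$ with $x\neq y$, $\|x\|=\|y\|=1$ and each $\delta>0$ there exists a $z\in X$ with $\|z\|<\delta$ such that $\|x+z\|\neq\|y+z\|$.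
   Context: A subset $A$ of a metric space $X$ is called quasi-finite if $A$ is infinite and every ball in $X$ contains only finitely many elements of $A$. Balls are open balls $B(y,r)$ with $r>0$; $\mathbb{N}$ is the set of positive integers; $|\cdot|$ applied to a set denotes its cardinality. *)

(* Defs.v *)
From mathcomp Require Import all_boot all_order all_algebra.
From mathcomp Require Import complex.
From mathcomp Require Import all_classical all_reals all_analysis.
Import Order.TTheory GRing.Theory Num.Theory.
Import numFieldNormedType.Exports.

Set Implicit Arguments.
Unset Strict Implicit.
Unset Printing Implicit Defensive.

Local Open Scope classical_set_scope.
Local Open Scope ring_scope.
Local Open Scope card_scope.

(* The scalar field K is generic so that real (K = R) and complex (K = R[i])
   spaces share the definitions.  Norms, radii and the bound delta live in K;
   for K = R[i], [0 < r] says that r is a positive real number.  In a normed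
   module, [ball y r] is the open ball [set x | `|y - x| < r]. *)

Definition quasi_finite (K : numFieldType) (X : pseudoMetricType K)
    (A : set X) : Prop :=
  infinite_set A /\
  forall (y : X) (r : K), 0 < r -> finite_set (A `&` ball y r).

Definition propS (K : numFieldType) (X : normedModType K) : Prop :=
  forall A : set X, quasi_finite A ->
  exists Y : set X, dense Y /\
    forall (y : X) (n : nat), Y y -> (0 < n)%N ->
    exists r : K, 0 < r /\ (A `&` ball y r) #= `I_n.

Definition propS1 (K : numFieldType) (X : normedModType K) : Prop :=
  forall A : set X, quasi_finite A ->
  exists Y : set X, dense Y /\
    forall y : X, Y y ->
    exists r : K, 0 < r /\ (A `&` ball y r) #= `I_1.

Definition propS' (K : numFieldType) (X : normedModType K) : Prop :=
  forall x y : X, x <> y -> `|x| = 1 -> `|y| = 1 ->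
  forall delta : K, 0 < delta ->
  exists z : X, `|z| < delta /\
    ((1 < `|x + z| /\ `|y + z| < 1) \/ (1 < `|y + z| /\ `|x + z| < 1)).

Definition propS'' (K : numFieldType) (X : normedModType K) : Prop :=
  forall x y : X, x <> y -> `|x| = 1 -> `|y| = 1 ->
  forall delta : K, 0 < delta ->
  exists z : X, `|z| < delta /\ `|x + z| <> `|y + z|.

(* Main.v *)
Require Import Defs.
From mathcomp Require Import all_boot all_order all_algebra.
From mathcomp Require Import complex.
From mathcomp Require Import all_classical all_reals all_analysis.
From mathcomp Require Import lra ring.
Import Order.TTheory GRing.Theory Num.Theory.
Import numFieldNormedType.Exports.

(**
The implications (S) => (S1) and (S') => (S'') are immediate.  The others
follow from (S1) => (S''), (S'') => (S') and (S'') => (S).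

(S'') => (S).  For a <> b in A, the set of y with |y - a| <> |y - b| is open,
and (S''), rescaled to a sphere through a and b, says that it is dense.  A
quasi-finite set is countable, so by Baire's theorem a dense set of points y
sees all points of A at different distances ([propS''_propS]).  From such a y
the points of A can be listed by increasing distance, and the open ball whose
radius is the distance to the point of rank n (counted from 0) contains exactly
n of them ([card_rball_of_inj_rdist]).

(S1) => (S'').  If |x + z| = |y + z| for all small z, then -x and -y are
equidistant from all points near 0.  Together with points far away they form a
quasi-finite set in which no ball centred near 0 contains exactly one point
([propS1_propS'']).

(S'') => (S').  Suppose that (S') fails at x and y.  Then the open unit ball
looks the same near x as near y: |x + z| < 1 if and only if |y + z| < 1, for z
small ([not_separated_imp]).  Convexity upgrades this single translation by
v = y - x to all its small fractions: near x, the unit ball is invariant under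
the translation by sv, for s small ([germ_shift]).  Rescaling by a factor t
close to 1 gives the same invariance for the ball of radius t, with st in
place of s.  All balls of radius close to 1 being invariant near x, so is the
norm: |x + sv + z| = |x + z| for z small and one fixed s > 0
([same_ball_germ_rnorm]).  This contradicts (S'') at the points x and x + sv.
*)

Set Implicit Arguments.
Unset Strict Implicit.
Unset Printing Implicit Defensive.

Local Open Scope classical_set_scope.
Local Open Scope ring_scope.
Local Open Scope card_scope.

(** * Real-valued norms over real and complex scalars *)

(** The order of the scalar field of a complex space is partial.  This record
retains what the real and complex cases share: the nonnegative scalars are real
numbers.  Norms can then be handled as elements of [R], whose order is total. *)
Structure real_scalars (R : realType) (K : numFieldType) := RealScalars {
  emb :> {rmorphism R -> K};
  rpart : K -> R;
  emb_le : {mono emb : a b / a <= b};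
  rpartK : forall k, 0 <= k -> emb (rpart k) = k }.

Definition self_scalars (R : realType) : real_scalars R R.
Proof. by exists idfun id. Defined.

Definition complex_scalars (R : realType) : real_scalars R R[i].
Proof.
exists (real_complex R) (@complex.Re R) => [a b|k k_ge0]; first exact: lecR.
exact/RRe_real/ger0_real.
Defined.

Section RealNorm.
Context (R : realType) (K : numFieldType) (S : real_scalars R K).
Implicit Types (a b r s t e : R).

Lemma emb_lt : {mono S : a b / a < b}.
Proof. exact/leW_mono/emb_le. Qed.

Lemma emb_gt0 r : (0 < S r) = (0 < r).
Proof. by rewrite -[X in X < _](rmorph0 S) emb_lt. Qed.

Lemma gt0_embP (k : K) : 0 < k -> exists2 r, 0 < r & k = S r.
Proof.
by move=> k0; exists (rpart S k); rewrite -?emb_gt0 rpartK// ltW.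
Qed.

Definition rnorm (X : normedModType K) (x : X) : R := rpart S `|x|.

Section Module.
Context (X : normedModType K).
Implicit Types (x y z u : X) (A U : set X).
Local Notation N := (@rnorm X).

Lemma emb_rnorm x : S (N x) = `|x|. Proof. exact: rpartK. Qed.

Lemma rnorm_ge0 x : 0 <= N x.
Proof. by rewrite -(emb_le S) rmorph0 emb_rnorm. Qed.

Lemma ltr_emb_rnorm x r : (`|x| < S r) = (N x < r).
Proof. by rewrite -emb_lt emb_rnorm. Qed.

Lemma rnormD x y : N (x + y) <= N x + N y.
Proof. by rewrite -(emb_le S) rmorphD/= !emb_rnorm ler_normD. Qed.

Lemma rnormZ a x : N (S a *: x) = `|a| * N x.
Proof.
apply: (fmorph_inj S); rewrite rmorphM/= !emb_rnorm normrZ; congr (_ * _).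
have S_ge0 b : (0 <= S b) = (0 <= b) by rewrite -(emb_le S) rmorph0.
have [a0|/ltW a0] := leP 0 a; first by rewrite !ger0_norm ?S_ge0.
by rewrite -normrN -rmorphN -[`|a|]normrN !ger0_norm ?S_ge0 ?oppr_ge0.
Qed.

Lemma rnormZ_ge0 a x : 0 <= a -> N (S a *: x) = a * N x.
Proof. by move=> a0; rewrite rnormZ ger0_norm. Qed.

Lemma rnormN x : N (- x) = N x. Proof. by rewrite /rnorm normrN. Qed.

Lemma rdistC x y : N (x - y) = N (y - x). Proof. by rewrite /rnorm distrC. Qed.

Lemma rdistD x y z : N (x - z) <= N (x - y) + N (y - z).
Proof. by rewrite -[in leLHS](subrKA y) rnormD. Qed.

Lemma rnorm0 : N 0 = 0.
Proof. by apply: (fmorph_inj S); rewrite emb_rnorm normr0 rmorph0. Qed.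

Lemma rnorm_eq0 x : N x = 0 -> x = 0.
Proof.
by move=> /(congr1 S); rewrite emb_rnorm rmorph0 => /normr0_eq0.
Qed.

Lemma norm_eq1 x : (`|x| = 1) <-> N x = 1.
Proof.
rewrite -emb_rnorm; split=> [|->]; last by rewrite rmorph1.
by rewrite -[1 in X in X -> _](rmorph1 S) => /(fmorph_inj S).
Qed.

Lemma ball_emb x r u : ball x (S r) u <-> N (x - u) < r.
Proof. by rewrite -emb_lt emb_rnorm -ball_normE. Qed.

Lemma open_rballP U :
  open U <-> forall x, U x -> exists2 r, 0 < r & forall u, N (x - u) < r -> U u.
Proof.
rewrite openE; split=> [oU x /oU/nbhs_ballP[k /= /gt0_embP[r r0 ->] xU]|oU x].
  by exists r => // u /ball_emb/xU.
case/oU => r r0 xU; apply/nbhs_ballP; exists (S r) => /=; rewrite ?emb_gt0//.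
by move=> u /ball_emb/xU.
Qed.

Lemma dense_rballP U :
  dense U <-> forall x r, 0 < r -> exists2 u, U u & N (x - u) < r.
Proof.
split=> [dU x r r0|dU O [x Ox] /open_rballP/(_ _ Ox)[r r0 rO]].
  have [|u [/ball_emb xu Uu]] := dU _ _ (ball_open x (S r)); last by exists u.
  by exists x; apply/ballxx; rewrite emb_gt0.
by have [u Uu /rO Ou] := dU x r r0; exists u.
Qed.

Lemma quasi_finiteP A : quasi_finite A <->
  infinite_set A /\ forall x r, finite_set (A `&` [set u | N (x - u) < r]).
Proof.
split=> -[Ai Af]; split=> // x r.
  have [r0|r0] := ltP 0 r.
    apply: sub_finite_set (Af x (S r) _); rewrite ?emb_gt0//.
    by move=> u [Au /ball_emb].
  rewrite [X in finite_set X](_ : _ = set0)//.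
  apply/seteqP; split=> // u [_ /=].
  by rewrite ltNge (le_trans r0)// rnorm_ge0.
case/gt0_embP => {}r _ ->; apply: sub_finite_set (Af x r).
by move=> u [Au /ball_emb].
Qed.

End Module.
End RealNorm.

(** * Equality of the norm at two points from equality of the unit ball *)

Section Translates.
Context (R : realType) (K : numFieldType) (S : real_scalars R K).
Context (X : normedModType K).
Implicit Types (x y z u v : X) (s t c d : R).
Local Notation N := (rnorm S).

Lemma rnorm_segment s x v c : 0 <= s <= 1 -> N x < c -> N (x + v) < c ->
  N (x + S s *: v) < c.
Proof.
move=> /andP[s0 s1] xc xvc.
have -> : x + S s *: v = S (1 - s) *: x + S s *: (x + v).
  by rewrite scalerDr addrA -scalerDl -rmorphD subrK rmorph1 scale1r.
apply: le_lt_trans (rnormD S _ _) _; rewrite !rnormZ_ge0 ?subr_ge0//.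
have [->|s_neq0] := eqVneq s 0; first by rewrite mul0r addr0 subr0 mul1r.
have : 0 < s by rewrite lt_def s_neq0.
by nra.
Qed.

(** Up to distance [d], the open unit ball has the same shape at [x] and at
[y]: the translation by [y - x] maps one piece onto the other. *)
Definition same_ball_germ x y d :=
  forall z, N z < d -> (N (x + z) < 1) = (N (y + z) < 1).

(** If [x + z] is in the open unit ball and [y + z] is outside it, then moving
[z] slightly in the direction of [y + z] pushes the second point strictly
outside, because the norm grows along rays, and keeps the first one inside. *)
Lemma not_separated_imp x y d :
  (forall z, N z < d -> ~ (1 < N (y + z) /\ N (x + z) < 1)) ->
  forall z, N z < d -> N (x + z) < 1 -> N (y + z) < 1.
Proof.
move=> nsep z zd xz1; rewrite ltNge; apply/negP => yz1.
have yz_gt0 : 0 < N (y + z) by lra.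
(* The displacement has norm [m / 2], which fits in both available margins. *)
pose m := Num.min (d - N z) (1 - N (x + z)).
have m_gt0 : 0 < m by rewrite lt_min !subr_gt0 zd.
have [md mx] : m <= d - N z /\ m <= 1 - N (x + z).
  by rewrite /m !ge_min !lexx orbT.
pose e := m / (2 * N (y + z)).
have e_gt0 : 0 < e by rewrite divr_gt0// mulr_gt0.
have eyz : e * N (y + z) = m / 2 by rewrite /e; field; rewrite gt_eqF.
have Nez : N (S e *: (y + z)) = m / 2 by rewrite rnormZ_ge0 ?ltW.
apply: (nsep (z + S e *: (y + z))).
  by have := rnormD S z (S e *: (y + z)); lra.
split; last by rewrite addrA; have := rnormD S (x + z) (S e *: (y + z)); lra.
rewrite addrA -[X in X + _]scale1r -(rmorph1 S) -scalerDl -rmorphD.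
by rewrite rnormZ_ge0; nra.
Qed.

(** One inclusion is convexity of the ball between [x + z] and [x + v + z].
Conversely, if [x + sv + z] is in the ball, so is its translate by [v], since
[sv + z] is small; the point [x + v + z] lies on the segment between the two,
hence is in the ball, and so is [x + z]. *)
Lemma germ_shift x v d s z : same_ball_germ x (x + v) d -> 0 <= s <= 1 ->
  N z < d / 2 -> s * N v < d / 2 ->
  (N (x + S s *: v + z) < 1) = (N (x + z) < 1).
Proof.
move=> germ s01 zd svd; have s0 : 0 <= s by case/andP: s01.
have N_z := rnorm_ge0 S z; have N_v := rnorm_ge0 S v.
have xzE : (N (x + z) < 1) = (N (x + v + z) < 1) by apply: germ; lra.
apply/idP/idP => [sz|xz]; last first.
  by rewrite addrAC rnorm_segment// addrAC -xzE.
have svz : N (x + S s *: v + z + v) < 1.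
  have -> : x + S s *: v + z + v = x + v + (S s *: v + z).
    by rewrite addrAC (addrAC x) addrA.
  rewrite -germ ?addrA//.
  by apply: le_lt_trans (rnormD S _ _) _; rewrite rnormZ_ge0//; lra.
have s01' : 0 <= 1 - s <= 1 by lra.
rewrite xzE; have := rnorm_segment s01' sz svz; congr (N _ < _).
by rewrite addrAC -(addrA x) -scalerDl -rmorphD subrKC rmorph1 scale1r.
Qed.

(** The sublevel set of level [t] near [x] is the unit ball near [x / t]
rescaled by [t]; for [t] close to 1 the point [x / t] is close to [x], so that
[germ_shift] applies with the fraction [s / t] of [v].  A shift that preserves
all sublevel sets of level close to 1 preserves the norm. *)
Lemma same_ball_germ_rnorm x v d : 0 < d -> N x = 1 -> N v <= 2 ->
  same_ball_germ x (x + v) d ->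
  exists s e, [/\ 0 < s, 0 < e &
    forall z, N z < e -> N (x + S s *: v + z) = N (x + z)].
Proof.
move=> d0 x1 v2 germ.
(* The levels considered are within [h] of 1.  For such [t] the displacement
   [w] below has norm at most [2 * (h + h / 2) <= 3 * d / 8 < d / 2]. *)
pose h := Num.min (1 / 2) (d / 8).
have h0 : 0 < h by rewrite lt_min !divr_gt0.
have [h1 hd] : h <= 1 / 2 /\ h <= d / 8 by rewrite /h !ge_min !lexx orbT.
exists (h / 4), (h / 2); split=> [||z zh]; rewrite ?divr_gt0//.
set s := h / 4; have s0 : 0 < s by rewrite divr_gt0.
have sv : N (S s *: v) <= h / 2.
  by rewrite rnormZ_ge0 ?(ltW s0)// /s; have := rnorm_ge0 S v; nra.
have sublevel t : 1 - h < t < 1 + h ->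
    (N (x + S s *: v + z) < t) = (N (x + z) < t).
  move=> /andP[ht th]; have t0 : 0 < t by lra.
  have St_neq0 : S t != 0 by rewrite fmorph_eq0 gt_eqF.
  have rescale u : (N u < t) = (N (S t^-1 *: u) < 1).
    by rewrite rnormZ_ge0 ?invr_ge0 1?ltW// mulrC ltr_pdivrMr// mul1r.
  pose w := S t^-1 *: (S (1 - t) *: x + z).
  have wE : S t^-1 *: (x + z) = x + w.
    rewrite /w !scalerDr addrA; congr (_ + _).
    rewrite scalerA -[X in _ = X + _]scale1r -(rmorph1 S) -rmorphM -scalerDl.
    by rewrite -rmorphD; congr (S _ *: _); field; rewrite gt_eqF.
  have vE : S t^-1 *: (x + S s *: v + z) = x + S (s / t) *: v + w.
    by rewrite addrAC scalerDr wE scalerA -rmorphM [t^-1 * s]mulrC addrAC.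
  have t_inv : t^-1 <= 2 by rewrite invf_ple ?posrE//; lra.
  have t_inv0 : 0 < t^-1 by rewrite invr_gt0.
  rewrite 2!rescale wE vE; apply: (germ_shift germ).
  - apply/andP; split; first by rewrite divr_ge0 ?ltW.
    by rewrite ler_pdivrMr// /s; lra.
  - rewrite /w rnormZ_ge0 ?ltW//.
    have := rnormD S (S (1 - t) *: x) z; rewrite rnormZ x1 mulr1.
    have : `|1 - t| < h by rewrite ltr_norml; lra.
    have := rnorm_ge0 S (S (1 - t) *: x + z); nra.
  - have st : s / t <= h / 2 by rewrite /s; nra.
    by have := rnorm_ge0 S v; nra.
have := rnormD S x z; have := rnormD S (x + z) (- z).
have := rnormD S (x + z) (S s *: v).
have := rnormD S (x + z + S s *: v) (- (S s *: v)).
rewrite !addrK !rnormN [x + z + _]addrAC => b1 b2 a1 a2.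
(* If the norms differed, the larger one would be a level that separates the
   two points. *)
have [ab|ab|//] := ltgtP (N (x + S s *: v + z)) (N (x + z)).
  have near1 : 1 - h < N (x + z) < 1 + h by lra.
  by have := sublevel _ near1; rewrite ab ltxx.
have near1 : 1 - h < N (x + S s *: v + z) < 1 + h by lra.
by have := sublevel _ near1; rewrite ab ltxx.
Qed.

(** If (S') fails at [x] and [y], then (S'') fails at [x] and a point of the
segment from [x] to [y] close to [x]. *)
Lemma propS''_propS' : propS'' X -> propS' X.
Proof.
move=> S'' x y xy /(norm_eq1 S) x1 /(norm_eq1 S) y1 delta.
case/(gt0_embP S) => d d0 ->; apply: contrapT => nsep.
have sepE (a b z : X) : (1 < `|a + z| /\ `|b + z| < 1) <->
    (1 < N (a + z) /\ N (b + z) < 1).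
  by rewrite -ltr_emb_rnorm rmorph1 -(emb_lt S) emb_rnorm rmorph1.
have germ : same_ball_germ x (x + (y - x)) d.
  rewrite subrKC => z zd; apply/idP/idP; apply: (not_separated_imp _ zd).
    move=> u ud sep; apply: nsep; exists u; rewrite ltr_emb_rnorm; split=> //.
    by right; apply/sepE.
  move=> u ud sep; apply: nsep; exists u; rewrite ltr_emb_rnorm; split=> //.
  by left; apply/sepE.
have xy2 : N (y - x) <= 2 by have := rnormD S y (- x); rewrite rnormN; lra.
have [s [e [s0 e0 eqN]]] := same_ball_germ_rnorm d0 x1 xy2 germ.
have x'1 : N (x + S s *: (y - x)) = 1.
  by have := eqN 0; rewrite !addr0 rnorm0 x1; apply.
have xx' : x <> x + S s *: (y - x).
  move=> /eqP; rewrite -[eqbLHS]addr0 (inj_eq (addrI _)) eq_sym scaler_eq0.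
  rewrite fmorph_eq0 gt_eqF//= subr_eq0 => /eqP yx; exact: xy.
have [z [ze]] := S'' x _ xx' ((norm_eq1 S _).2 x1) ((norm_eq1 S _).2 x'1)
  (S e) ltac:(by rewrite emb_gt0).
by apply; rewrite -!(emb_rnorm S) eqN// -ltr_emb_rnorm.
Qed.

End Translates.

(** * Baire's theorem *)

Section Baire.
Context (R : realType) (K : numFieldType) (S : real_scalars R K).
Local Notation N := (rnorm S).

(** The usual nested balls, over scalars that cover the real and the complex
case at once: the step halves the radius and sends a closed ball into the
previous open ball, inside the next open set. *)
Lemma baire (X : completeNormedModType K) (F : (set X)^nat) :
  (forall i, open (F i) /\ dense (F i)) -> dense (\bigcap_i F i).
Proof.
move=> F_od; apply/(dense_rballP S) => x0 r0 r0_gt0.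
pose shrinks n (p q : X * R) := [/\ 0 < q.2, q.2 <= p.2 / 2 &
  forall u, N (q.1 - u) <= q.2 -> N (p.1 - u) < p.2 /\ F n u].
(* The step is total, to allow choice; it only matters for positive radii. *)
have step (np : nat * (X * R)) : exists q, 0 < np.2.2 -> shrinks np.1 np.2 q.
  case: np => n [x r] /=; have [r_gt0|] := ltP 0 r; last by exists (x, r).
  have [/(open_rballP S) oF /(dense_rballP S) dF] := F_od n.
  have [u Fu xu] := dF x r r_gt0; have [e e_gt0 ue] := oF u Fu.
  have [m_e m_r] : Num.min (e / 2) ((r - N (x - u)) / 2) <= e / 2 /\
      Num.min (e / 2) ((r - N (x - u)) / 2) <= (r - N (x - u)) / 2.
    by rewrite !ge_min !lexx orbT.
  have m_gt0 : 0 < Num.min (e / 2) ((r - N (x - u)) / 2).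
    by rewrite lt_min !divr_gt0// subr_gt0.
  exists (u, Num.min (e / 2) ((r - N (x - u)) / 2)) => _; split=> //=.
    by have := rnorm_ge0 S (x - u); lra.
  move=> w uw; split; last by apply: ue; lra.
  have := rdistD S x u w; lra.
have [f fP] := choice step.
pose c := fix c n := if n is n'.+1 then f (n', c n') else (x0, r0).
have c_gt0 n : 0 < (c n).2 by elim: n => //= n /(fP (n, c n))[].
have cS n : shrinks n (c n) (c n.+1) := fP (n, c n) (c_gt0 n).
have c_nested m n : (m <= n)%N ->
    forall u, N ((c n).1 - u) <= (c n).2 -> N ((c m).1 - u) <= (c m).2.
  move=> /subnK<-; elim: (n - m)%N => // k IH u.
  by rewrite addSn; have [_ _ /[apply] -[/ltW/IH]] := cS (k + m)%N.
have c_center m n : (m <= n)%N -> N ((c m).1 - (c n).1) <= (c m).2.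
  by move=> /c_nested; apply; rewrite subrr rnorm0 ltW.
have c_small n : (c n).2 <= r0 / 2 ^+ n.
  elim: n => [|n IH]; first by rewrite expr0 divr1.
  have [_ + _] := cS n; rewrite exprS invfM mulrCA => /le_trans; apply.
  by rewrite mulrC ler_pM2l ?invr_gt0.
have c_lim e : 0 < e -> exists n, (c n).2 < e.
  move=> e_gt0; exists (Num.truncn (r0 / e)).+1.
  apply: le_lt_trans (c_small _) _; rewrite ltr_pdivrMr ?exprn_gt0// mulrC.
  rewrite -ltr_pdivrMr//; apply: lt_le_trans (truncnS_gt _) _.
  by rewrite -natrX ler_nat ltnW// ltn_expl.
have : cvg ((fun n => (c n).1) @ \oo).
  apply: cauchy_cvg; apply: cauchy_exP => _ /(gt0_embP S)[e e_gt0 ->].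
  have [n cn] := c_lim e e_gt0; exists (c n).1, n => // m /= nm.
  by apply/ball_emb/(le_lt_trans _ cn)/c_center.
move=> /cvg_ex[l /cvgrPdist_lt cl].
have c_l m : N ((c m).1 - l) <= (c m).2.
  apply/ler_addgt0Pr => e e_gt0.
  have := cl (S e); rewrite emb_gt0 => /(_ e_gt0)[n _].
  move=> /(_ (maxn n m) (leq_maxl _ _)) /=; rewrite -(emb_rnorm S) emb_lt => ln.
  have := rdistD S (c m).1 (c (maxn n m)).1 l.
  have := c_center m _ (leq_maxr n m).
  by rewrite rdistC in ln; lra.
exists l => [n _|]; first by have [_ _ /(_ _ (c_l n.+1))[]] := cS n.
by have [_ _ /(_ _ (c_l 1%N))[]] := cS 0%N.
Qed.

End Baire.

(** * Points that see a quasi-finite set at distinct distances *)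

Section Distances.
Context (R : realType) (K : numFieldType) (S : real_scalars R K).
Local Notation N := (rnorm S).

Lemma finite_argmin T (f : T -> R) (B : set T) : finite_set B -> B !=set0 ->
  exists2 m, B m & forall b, B b -> f m <= f b.
Proof.
elim/Pchoice: T => T in f B *.
move=> /finite_seqP[s ->]; elim: s => [[]//|a [|a' s] IH _].
  by exists a => [|b] /=; rewrite inE// => /eqP->.
have [|m ms mf] := IH; first by exists a'; exact: mem_head.
have [am|ma] := leP (f a) (f m).
  exists a; first exact: mem_head.
  by move=> b; rewrite /= in_cons => /orP[/eqP->//|/mf]; exact: le_trans.
exists m; first by rewrite /= in_cons ms orbT.
by move=> b; rewrite /= in_cons => /orP[/eqP->|/mf//]; exact: ltW.
Qed.

Lemma quasi_finite_countable (X : normedModType K) (A : set X) :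
  quasi_finite A -> countable A.
Proof.
case/(quasi_finiteP S) => _ Af.
have -> : A = \bigcup_n (A `&` [set u | N (0 - u) < n%:R]).
  apply/seteqP; split=> [u Au|u [n _ []]//].
  by exists (Num.truncn (N (0 - u))).+1 => //; split=> //; exact: truncnS_gt.
by apply: bigcup_countable => // n _; apply: finite_set_countable.
Qed.

Lemma open_rdist_neq (X : normedModType K) (a b : X) :
  open [set u | N (u - a) <> N (u - b)].
Proof.
apply/(open_rballP S) => u /= /eqP uab.
exists (`|N (u - a) - N (u - b)| / 2) => [|w uw].
  by rewrite divr_gt0// normr_gt0 subr_eq0.
have := rdistD S u w a; have := rdistD S u w b.
have := rdistD S w u a; have := rdistD S w u b; rewrite (rdistC S w u).
by move: uw; case: (ler0P (N (u - a) - N (u - b))); lra.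
Qed.

(** At a point [u] equidistant from [a] and [b], both [u - a] and [u - b] lie
on a sphere centred at 0; after normalisation, (S'') moves [u] slightly off the
set of equidistant points. *)
Lemma dense_rdist_neq (X : normedModType K) (a b : X) :
  propS'' X -> a <> b -> dense [set u | N (u - a) <> N (u - b)].
Proof.
move=> S'' ab; apply/(dense_rballP S) => u r r0.
have [uab|uab] := eqVneq (N (u - a)) (N (u - b)); last first.
  by exists u; [exact/eqP|rewrite subrr rnorm0].
have ua0 : 0 < N (u - a).
  rewrite lt_def rnorm_ge0 andbT; apply/eqP => ua.
  have ub : N (u - b) = 0 by rewrite -uab.
  by apply: ab; rewrite -(subr0_eq (rnorm_eq0 ua)) (subr0_eq (rnorm_eq0 ub)).
set t := N (u - a) in uab ua0 *.
have t_neq0 : S t != 0 by rewrite fmorph_eq0 gt_eqF.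
have unit c : N (u - c) = t -> `|S t^-1 *: (u - c)| = 1.
  move=> uc; apply/(norm_eq1 S); rewrite rnormZ_ge0 ?uc ?mulVf ?gt_eqF//.
  by rewrite invr_ge0 ltW.
have [||z [zr zab]] := S'' _ _ _ (unit a erefl) (unit b (esym uab)) (S (r / t)).
- rewrite fmorphV => /(scalerI (invr_neq0 t_neq0))/addrI/oppr_inj; exact: ab.
- by rewrite emb_gt0 divr_gt0.
have shiftE c : u + S t *: z - c = S t *: (S t^-1 *: (u - c) + z).
  by rewrite scalerDr scalerA -rmorphM mulfV ?gt_eqF// rmorph1 scale1r addrAC.
exists (u + S t *: z) => /=.
  rewrite !shiftE !rnormZ => /mulfI; rewrite normr_eq0 gt_eqF// => /(_ isT) E.
  by apply: zab; rewrite -!(emb_rnorm S) E.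
rewrite opprD addNKr rnormN rnormZ_ge0 ?ltW// mulrC -ltr_pdivlMr//.
by rewrite -(emb_lt S) emb_rnorm.
Qed.

(** By induction on [n]: [b] is the point of [A] of rank [n] by distance to [y],
counted from 0.  The next one is the nearest among the points strictly farther
than [b]; since distances are distinct, the open ball that reaches it gains
exactly the point [b]. *)
Lemma card_rball_of_inj_rdist (X : normedModType K) (A : set X) (y : X) :
  quasi_finite A ->
  (forall a b, A a -> A b -> N (y - a) = N (y - b) -> a = b) ->
  forall n, exists2 b, A b & (A `&` [set u | N (y - u) < N (y - b)]) #= `I_n.
Proof.
case/(quasi_finiteP S) => Ai Af inj.
have nearest (B : set X) : B `<=` A -> B !=set0 ->
    exists2 b, B b & forall a, B a -> N (y - b) <= N (y - a).
  move=> BA [b0 Bb0].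
  have [|| b [Bb _] bmin] := @finite_argmin _ (fun u => N (y - u))
    (B `&` [set u | N (y - u) < N (y - b0) + 1]).
  - by apply: sub_finite_set (Af y (N (y - b0) + 1)) => u [/BA].
  - by exists b0; split=> //=; lra.
  exists b => // a Ba; have [ab|ab] := ltP (N (y - a)) (N (y - b0) + 1).
    exact: bmin.
  by apply: le_trans (bmin b0 _) _; [split=> //=|]; lra.
elim=> [|n [b Ab bn]].
  have [b Ab bmin] := nearest A (@subset_refl _ A) (infinite_setN0 Ai).
  exists b => //; rewrite II0 card_eq0.
  apply/eqP/seteqP; split=> // u [/bmin] /=.
  by rewrite leNgt => /negP.
have [||c [Ac /= /negP]] := nearest (A `\` [set u | N (y - u) <= N (y - b)]).
- by move=> u [].
- apply/set0P/eqP => B0; apply: Ai.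
  apply: sub_finite_set (Af y (N (y - b) + 1)).
  move=> u Au; split=> //=; rewrite ltNge; apply/negP => ub.
  have : (A `\` [set u | N (y - u) <= N (y - b)]) u by split=> //=; lra.
  by rewrite B0.
rewrite -ltNge => bc cmin; exists c => //; apply/eq_cardSP; exists b => //.
rewrite [X in X #= _](_ : _ = A `&` [set u | N (y - u) < N (y - b)])//.
apply/seteqP; split=> u /= => [[[Au uc] ub]|[Au ub]]; split=> //.
- rewrite ltNge le_eqVlt; apply/negP => /orP[/eqP/inj bu|bu].
    exact/ub/esym/bu.
  suff : N (y - c) <= N (y - u) by lra.
  by apply: cmin; split=> //=; lra.
- by split=> //; lra.
- by move=> ub'; move: ub; rewrite ub' ltxx.
Qed.

(** Points that see [A] at distinct distances form a countable intersection of
dense open sets, indexed by codes of pairs of points of [A]. *)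
Lemma propS''_propS (X : completeNormedModType K) : propS'' X -> propS X.
Proof.
move=> S'' A Aqf; have /countable_injP[f finj] := quasi_finite_countable Aqf.
pose code (ab : X * X) := choice.pickle (f ab.1, f ab.2).
pose F n := [set y | forall a b, A a -> A b -> a <> b -> code (a, b) = n ->
  N (y - a) <> N (y - b)].
exists (\bigcap_n F n); split.
  apply: (baire S) => n.
  have [[[a b] [Aa Ab ab abn]]|noab] := pselect (exists ab : X * X,
      [/\ A ab.1, A ab.2, ab.1 <> ab.2 & code ab = n]).
    have -> : F n = [set y | N (y - a) <> N (y - b)].
      apply/seteqP; split=> y /=; first exact.
      move=> yab a' b' Aa' Ab' _; rewrite -abn => /(pcan_inj choice.pickleK)[].
      move=> /(finj _ _ (mem_set Aa') (mem_set Aa))->.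
      by move=> /(finj _ _ (mem_set Ab') (mem_set Ab))->.
    by split; [exact: open_rdist_neq|exact: dense_rdist_neq].
  have -> : F n = setT.
    apply/seteqP; split=> // y _ a b Aa Ab ab abn.
    by case: noab; exists (a, b).
  by split; [exact: openT|move=> O [x Ox] _; exists x].
move=> y n Yy n_gt0.
have inj a b : A a -> A b -> N (y - a) = N (y - b) -> a = b.
  by move=> Aa Ab yab; apply: contrapT => ab; exact: (Yy (code (a, b)) I a b).
have [b Ab bn] := card_rball_of_inj_rdist Aqf inj n.
have AE : A `&` ball y (S (N (y - b))) = A `&` [set u | N (y - u) < N (y - b)].
  by congr (_ `&` _); apply/seteqP; split=> u /ball_emb.
exists (S (N (y - b))); rewrite AE emb_gt0; split=> //.
case: n n_gt0 bn {AE} => // n _ /eq_cardSP[u [_ /=] /(le_lt_trans _) yb _].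
exact/yb/rnorm_ge0.
Qed.

End Distances.

(** * The equivalence *)

Lemma card_II1_eq T (A : set T) (a b : T) : A #= `I_1 -> A a -> A b -> a = b.
Proof.
case/eq_cardSP => c _; rewrite II0 card_eq0 => /eqP Ac Aa Ab.
have eqc u : A u -> u = c.
  by move=> Au; apply: contrapT => uc; have : (A `\ c) u by []; rewrite Ac.
by rewrite (eqc a)// (eqc b).
Qed.

Section Equivalence.
Context (R : realType) (K : numFieldType) (S : real_scalars R K).
Local Notation N := (rnorm S).

(** The set is [-x], [-y] and the multiples [(k + 5) x].  From a point [z] of
norm less than 1, the first two are at distance less than 2 and, when [z] is
small enough, equidistant; the multiples are at distance greater than 4. *)
Lemma propS1_propS'' (X : normedModType K) : propS1 X -> propS'' X.
Proof.
move=> S1 x y xy /(norm_eq1 S) x1 /(norm_eq1 S) y1 delta.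
case/(gt0_embP S) => d d0 ->; apply: contrapT => eqn.
have {}eqn z : N z < d -> N (x + z) = N (y + z).
  move=> zd; apply: contrapT => ne; apply: eqn; exists z.
  by rewrite -(emb_rnorm S) emb_lt -!(emb_rnorm S); split=> // /(fmorph_inj S).
pose p k := S (k + 5)%:R *: x.
have N_p k : N (p k) = (k + 5)%:R by rewrite rnormZ_ge0 ?x1 ?mulr1// ler0n.
pose A := [set - x; - y] `|` range p.
have Aqf : quasi_finite A.
  apply/(quasi_finiteP S); split.
    apply: (@sub_infinite_set _ (range p)); first exact: subsetUr.
    have p_inj : {in setT &, injective p}.
      move=> i j _ _ /(congr1 (rnorm S (X:=X))); rewrite !N_p => /eqP.
      by rewrite eqr_nat eqn_add2r => /eqP.
    by rewrite (eq_finite_set (inj_card_eq p_inj)); exact: infinite_nat.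
  move=> u r; pose m := (Num.truncn (r + N u)).+1.
  apply: (@sub_finite_set _ _ ([set - x; - y] `|` p @` `I_m)).
    move=> w [[wxy _|[k _ <-] /=]]; [by left|right; exists k => //=].
    rewrite -(ltr_nat R); apply: le_lt_trans (truncnS_gt _).
    have := rdistD S 0 u (p k); rewrite !sub0r !rnormN N_p natrD; lra.
  by rewrite finite_setU; split; [exact: finite_set2|exact: finite_image].
have [Y [/(dense_rballP S) dY Yball]] := S1 A Aqf.
have [z Yz] := dY 0 (Num.min d 1) ltac:(by rewrite lt_min d0 ltr01).
rewrite sub0r rnormN lt_min => /andP[zd z1].
have [_ [/(gt0_embP S)[r r0 ->] card1]] := Yball z Yz.
have [c Ac zc] : exists2 c, A c & N (z - c) < r.
  by have [c [Ac /(ball_emb S) zc] _] := eq_cardSP _ _ card1; exists c.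
have zxy : N (z - - x) = N (z - - y) by rewrite !opprK ![z + _]addrC eqn.
have zx : N (z - - x) < r.
  case: Ac zc => [[->|->]|[k _ <-]]; rewrite ?zxy// => zk.
  have := rdistD S 0 z (p k); rewrite !sub0r !rnormN N_p natrD.
  have := rnormD S z x; have : 0 <= k%:R :> R by rewrite ler0n.
  by rewrite -zxy opprK x1; lra.
have := card_II1_eq card1 (a := - x) (b := - y).
have -> : (- x = - y) <-> False by split=> // /oppr_inj.
apply; split; [by left; left|exact/ball_emb|by left; right|].
by apply/ball_emb; rewrite -zxy.
Qed.

Lemma propS_tfae (X : completeNormedModType K) :
  [<-> propS X; propS1 X; propS' X; propS'' X].
Proof.
tfae.
- move=> propSX A /propSX[Y [dY YA]].
  by exists Y; split=> // y Yy; exact: YA.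
- by move=> /propS1_propS''/(propS''_propS' S).
- move=> S' x y xy x1 y1 delta delta0.
  have [z [zd sep]] := S' x y xy x1 y1 delta delta0.
  exists z; split=> // eqxy.
  by case: sep => -[]; rewrite eqxy => /lt_trans/[apply]; rewrite ltxx.
- exact: (propS''_propS S).
Qed.

End Equivalence.

Theorem theoremA (R : realType) :
  (forall X : completeNormedModType R,
     [<-> propS X; propS1 X; propS' X; propS'' X]) /\
  (forall X : completeNormedModType R[i],
     [<-> propS X; propS1 X; propS' X; propS'' X]).
Proof.
split=> X; first exact: propS_tfae (self_scalars R) X.
exact: propS_tfae (complex_scalars R) X.
Qed.
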